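(* Let $b\in\mathbb{N}$ with $b\geq 2$ and $b\neq 3$. Then the number of integers $a$ with $1\leq a\leq b-1$, $(a,b)=1$ and $S(1,a,b)=-\frac{b}{2}$ equals $$\phi\left(b,\left\lceil \frac{2b+1}{3}\right\rceil,\left\lfloor \frac{3b-1}{3}\right\rfloor\right).$$
   Context: $\mathbb{N}$ denotes the positive integers and $(a,b)$ the greatest common divisor. For $n,a,b\in\mathbb{N}$ with $b\geq 2$, define $$S(n,a,b):=\sum_{m=1}^{b-1}\cot\left(\frac{\pi m}{b}\right)\sin^{3}\left(2\pi mn\frac{a}{b}\right).$$ The generalized totient function is $$\phi(n,A,B):=\sum_{\substack{A\leq k\leq B\\ (n,k)=1}}1,$$ the number of integers $k$ with $A\leq k\leq B$ and $(n,k)=1$ (equal to $0$ if there are none). *)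

(* Defs.v *)
From mathcomp Require Import all_boot all_order all_algebra.
From mathcomp Require Import all_classical all_reals all_analysis.

Set Implicit Arguments.
Unset Strict Implicit.
Unset Printing Implicit Defensive.

Import Order.TTheory GRing.Theory Num.Theory.

Local Open Scope classical_set_scope.
Local Open Scope ring_scope.

Definition cot (R : realType) (x : R) : R := cos x / sin x.

Definition cotsin3_sum (R : realType) (n a b : nat) : R :=
  \sum_(1 <= m < b)
    cot (pi * m%:R / b%:R) * sin (2 * pi * m%:R * n%:R * (a%:R / b%:R)) ^+ 3.

(* The set is finite, so this finitely supported sum is never the default 0;
   an empty range, in particular B < A, gives 0. *)
Definition gtotient (n : nat) (A B : int) : nat :=
  \sum_(k \in [set k : int | (A <= k <= B) && coprimez n%:Z k]) 1%N.

(* Main.v *)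
Require Import Defs.
From mathcomp Require Import all_boot all_order all_algebra.
From mathcomp Require Import all_classical all_reals all_analysis.
From mathcomp Require Import ring lra zify.

Import Order.TTheory GRing.Theory Num.Theory.

Local Open Scope ring_scope.

(** By sin^3 t = (3 sin t - sin 3t) / 4, S(1,a,b) is a combination of the sums
    f(a) = sum_m cot(pi m / b) sin(2 pi m a / b) at a and 3a. The difference
    f(a+1) - f(a) is a sum of cosines over b-th roots of unity, which gives
    f(a) = b - 2a for 0 < a < b, and f is b-periodic. When a is coprime to b and
    b <> 3, 3a is not divisible by b, whence S(1,a,b) = b (1 - floor(3a/b)) / 2;
    this is -b/2 iff 2b <= 3a, and equality 2b = 3a is excluded. *)

(** By Gauss, [b] would divide 3, leaving only [b = 1] or [b = 3]. *)
Lemma coprime_dvdn3M (a b : nat) :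
  (1 < b)%N -> b <> 3%N -> coprime a b -> ~~ (b %| 3 * a)%N.
Proof.
move=> b1 b3 cab; rewrite Gauss_dvdl 1?coprime_sym//.
apply/negP => b_dvd3; have := dvdn_leq (isT : (0 < 3)%N) b_dvd3.
by case: b b1 b3 b_dvd3 {cab} => [|[|[|[|]]]].
Qed.

Section CotangentSums.
Variable R : realType.

Lemma sinDnat2pi (k : nat) (x : R) : sin (x + 2 * pi * k%:R) = sin x.
Proof.
rewrite -[RHS](periodicn (@sinD2pi R) k x); congr (sin (_ + _)).
by rewrite mulr_natr mulr_natl.
Qed.

Lemma sin3M (x : R) : sin (3 * x) = 3 * sin x - 4 * sin x ^+ 3.
Proof.
have -> : 3 * x = x + x + x by ring.
rewrite !sinD !cosD; have := cos2sin2 x.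
move: (sin x) (cos x) => s c h.
have -> : (s * c + c * s) * c + (c * c - s * s) * s = 3 * (c ^+ 2 * s) - s ^+ 3.
  by ring.
by rewrite h; ring.
Qed.

Lemma sin_pi_div_neq0 (a b : nat) : (0 < a < b)%N ->
  sin (pi * a%:R / b%:R : R) != 0.
Proof.
move=> /andP[a0 ab]; have b0 : 0 < b%:R :> R by rewrite ltr0n; apply: leq_trans ab.
rewrite gt_eqF// sin_gt0_pi//; apply/andP; split.
  by rewrite divr_gt0// mulr_gt0 ?pi_gt0// ltr0n.
by rewrite ltr_pdivrMr// ltr_pM2l ?pi_gt0// ltr_nat.
Qed.

Lemma sum_cos_eq0 (a b : nat) : (0 < a < b)%N ->
  \sum_(0 <= m < b) cos (2 * pi * m%:R * (a%:R / b%:R)) = 0 :> R.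
Proof.
move=> hab; have sy := sin_pi_div_neq0 _ _ hab.
have b0 : b%:R != 0 :> R by rewrite pnatr_eq0; lia.
set y : R := pi * a%:R / b%:R in sy.
apply: (mulfI sy); rewrite mulr0 mulr_sumr.
(* With [y = pi * a / b], [sin y * cos (2 * m * y)] is half of [sin ((2 * m + 1) * y) - sin ((2 * m
   - 1) * y)], so the sum telescopes; the two ends agree modulo [2 * pi * a]. *)
pose u (m : nat) : R := sin ((2 * m%:R - 1) * y) / 2.
rewrite (eq_bigr (fun m => u m.+1 - u m)); last first.
  move=> m _; rewrite /u -(natr1 m).
  have -> : (2 * (m%:R + 1) - 1) * y = 2 * m%:R * y + y by ring.
  have -> : (2 * m%:R - 1) * y = 2 * m%:R * y - y by ring.
  have -> : 2 * pi * m%:R * (a%:R / b%:R) = 2 * m%:R * y by rewrite /y; ring.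
  by rewrite sinD sinB; field.
rewrite telescope_sumr// /u.
have -> : (2 * b%:R - 1) * y = - y + 2 * pi * a%:R by rewrite /y; field.
by rewrite sinDnat2pi mulr0 sub0r mulN1r subrr.
Qed.

Definition cotsin_sum (a b : nat) : R :=
  \sum_(1 <= m < b) cot (pi * m%:R / b%:R) * sin (2 * pi * m%:R * (a%:R / b%:R)).

Lemma cotsin_sum0 (b : nat) : cotsin_sum 0 b = 0.
Proof. by apply: big1 => m _; rewrite mul0r mulr0 sin0 mulr0. Qed.

(** Termwise, [cot x * (sin (w + x) - sin (w - x)) = 2 * cos x * cos w = cos (w - x) + cos (w + x)].
    The [- 2] removes the two terms at [m = 0], which the cotangent sum does not have. *)
Lemma cotsin_sumS (a b : nat) : (0 < b)%N ->
  cotsin_sum a.+1 b = cotsin_sum a b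
  + \sum_(0 <= m < b) cos (2 * pi * m%:R * (a%:R / b%:R))
  + \sum_(0 <= m < b) cos (2 * pi * m%:R * (a.+1%:R / b%:R)) - 2.
Proof.
move=> b0; rewrite ![\sum_(0 <= m < b) _]big_ltn// !mulr0 !mul0r cos0.
have -> (x y z : R) : x + (1 + y) + (1 + z) - 2 = x + y + z by ring.
rewrite /cotsin_sum -!big_split /=; apply: eq_big_nat => m /andP[m0 mb].
have sx : sin (pi * m%:R / b%:R : R) != 0 by rewrite sin_pi_div_neq0 ?m0.
set x : R := pi * m%:R / b%:R in sx *.
pose w : R := 2 * pi * m%:R * (a%:R / b%:R) + x.
have -> : 2 * pi * m%:R * (a.+1%:R / b%:R) = w + x.
  by rewrite -(natr1 a) /w /x; ring.
have -> : 2 * pi * m%:R * (a%:R / b%:R) = w - x by rewrite /w; ring.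
by rewrite /cot (sinD w) (sinB w) (cosB w) (cosD w); field.
Qed.

Lemma cotsin_sumE (a b : nat) : (0 < a < b)%N ->
  cotsin_sum a b = b%:R - 2 * a%:R.
Proof.
case: a => // a; elim: a => [|a IH] hab.
  (* At frequency 0 the cosine sum is [b] instead of 0, so the value at 1 is [b - 2]. *)
  rewrite cotsin_sumS; last by lia.
  rewrite cotsin_sum0 (sum_cos_eq0 1)// (eq_bigr (fun=> 1)); last first.
    by move=> m _; rewrite mul0r mulr0 cos0.
  by rewrite sumr_const_nat subn0; ring.
rewrite cotsin_sumS; last by lia.
rewrite IH ?(sum_cos_eq0 a.+1) ?(sum_cos_eq0 a.+2)//; try lia.
by rewrite -(natr1 a.+1); ring.
Qed.

Lemma cotsin_sum_mod (a b : nat) : cotsin_sum (a %% b) b = cotsin_sum a b.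
Proof.
have [->|b0] := posnP b; first by rewrite modn0.
have bR : b%:R != 0 :> R by rewrite pnatr_eq0 -lt0n.
apply: eq_bigr => m _; rewrite -(sinDnat2pi (m * (a %/ b))).
congr (_ * sin _); rewrite [in RHS](divn_eq a b) natrD !natrM.
by field.
Qed.

Lemma cotsin3_sumE (a b : nat) :
  cotsin3_sum R 1 a b = (3 * cotsin_sum a b - cotsin_sum (3 * a) b) / 4.
Proof.
rewrite mulr_sumr -sumrB mulr_suml; apply: eq_bigr => m _.
rewrite mulr1 natrM.
have -> : 2 * pi * m%:R * (3 * a%:R / b%:R) = 3 * (2 * pi * m%:R * (a%:R / b%:R)) :> R.
  by ring.
by rewrite sin3M; field.
Qed.

Lemma cotsin3_sum_coprime (a b : nat) :
    (1 < b)%N -> b <> 3%N -> (a < b)%N -> coprime a b ->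
  cotsin3_sum R 1 a b = b%:R * (1 - (3 * a %/ b)%:R) / 2.
Proof.
move=> b1 b3 ab cab.
have a0 : (0 < a)%N.
  by rewrite lt0n; apply: contraTN cab => /eqP ->; rewrite /coprime gcd0n; lia.
(* A zero remainder would fall outside the range of [cotsin_sumE]. *)
have r0 : (0 < 3 * a %% b)%N by rewrite lt0n coprime_dvdn3M.
rewrite cotsin3_sumE -[cotsin_sum (3 * a) b]cotsin_sum_mod !cotsin_sumE; last 2 first.
- by rewrite r0 ltn_mod; lia.
- by rewrite a0.
have -> : (3 * a %% b)%:R = 3 * a%:R - (3 * a %/ b)%:R * b%:R :> R.
  by rewrite -!natrM {2}(divn_eq (3 * a) b) natrD addrAC subrr add0r.
by field.
Qed.

End CotangentSums.

(** The bounds on [A] and [B] confine the counted integers to the values of ['I_b], so that both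
    counts of the theorem can be compared pointwise. *)
Lemma gtotientE (b : nat) (A B : int) : 0 <= A -> B < b%:Z ->
  gtotient b A B = #|[set a : 'I_b | (A <= a%:Z <= B) && coprime a b]|.
Proof.
move=> A0 Bb; rewrite /gtotient -sum1_card -big_enum (fsbig_seq _ _ (enum_uniq _)).
apply: (reindex_fsbig (fun a : 'I_b => a%:Z)); split.
- by move=> a /=; rewrite mem_enum inE coprimezE coprime_sym.
- by move=> x y _ _ [] /val_inj.
move=> [k|k] /= /andP[/andP[Ak kB] cbk]; last by lia.
have kb : (k < b)%N by lia.
by exists (Ordinal kb) => //=; rewrite mem_enum inE Ak kB coprime_sym.
Qed.

Theorem corollary1p8 (R : realType) (b : nat) (hb2 : (2 <= b)%N) (hb3 : b <> 3%N) :
  #|[set a : 'I_b | [&& (1 <= a)%N, coprime a b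
                      & cotsin3_sum R 1 a b == - (b%:R / 2)]]|
  = gtotient b (Num.ceil ((2 * b%:R + 1) / 3 : rat))
               (Num.floor ((3 * b%:R - 1) / 3 : rat)).
Proof.
have b0 : 0 <= b%:R :> rat by [].
rewrite gtotientE; last 2 first.
- by rewrite ceil_ge0; lra.
- by rewrite floor_lt_int; lra.
apply: eq_card => a; rewrite !inE.
have [cab|] := boolP (coprime a b); last by rewrite !andbF.
have ab := ltn_ord a.
rewrite andbT ceil_le_int floor_ge_int cotsin3_sum_coprime//.
(* The upper bound is [b - 1/3], so it holds for every [a < b]. *)
have -> : (a%:Z%:~R : rat) <= (3 * b%:R - 1) / 3.
  have : (a.+1%:R : rat) <= b%:R by rewrite ler_nat.
  by rewrite -natr1 -pmulrn; lra.
have -> : ((2 * b%:R + 1) / 3 <= a%:Z%:~R :> rat) = (2 * b < 3 * a)%N.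
  by rewrite ler_pdivrMr// -pmulrn -!natrM natr1 ler_nat [(a * 3)%N]mulnC.
have -> : (b%:R * (1 - (3 * a %/ b)%:R) / 2 == - (b%:R / 2) :> R) = (3 * a %/ b == 2)%N.
  have bR : b%:R != 0 :> R by rewrite pnatr_eq0; lia.
  rewrite -[RHS](eqr_nat R); apply/eqP/eqP => [h|->]; last by field.
  have /(mulfI bR) : b%:R * (1 - (3 * a %/ b)%:R) = b%:R * -1 :> R by lra.
  by lra.
(* Quotient 2 only gives [2 * b <= 3 * a]; this makes the inequality strict. *)
have ne : (3 * a != 2 * b)%N.
  by apply: contraNneq (coprime_dvdn3M _ _ hb2 hb3 cab) => ->; rewrite dvdn_mull.
rewrite andbT; apply/andP/idP => [[_ /eqP q]|h].
  by have := divn_eq (3 * a) b; rewrite q; lia.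
split; first by lia.
(* The quotient is below 3 because [a < b]. *)
by rewrite eqn_leq leq_divRL ?(ltnW hb2)// -ltnS ltn_divLR; lia.
Qed.
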